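(* Let $X$ be a compact, finite-dimensional metrizable space. Let $Q$ be the set of all $d\in\mathrm{Met}(X)$ such that $(X,d)$ is isometrically embeddable into $(\mathbb{R}^N,\|\cdot\|_\infty)$ for some integer $N\ge1$, where $\|\cdot\|_\infty$ is the $\ell^\infty$-norm. Then $Q$ is dense in $(\mathrm{Met}(X),\mathcal{D}_X)$.
   Context: $\mathrm{Met}(X)$ is the set of all metrics on $X$ generating its topology, and $\mathcal{D}_X(d,e)=\sup_{x,y\in X}|d(x,y)-e(x,y)|$. Finite-dimensional means finite covering dimension. *)

(* Defs.v *)
From HB Require Import structures.
From mathcomp Require Import all_boot all_order all_algebra.
From mathcomp Require Import all_classical all_reals all_analysis.
Unset Strict Implicit. Unset Printing Implicit Defensive.
Import Order.TTheory GRing.Theory Num.Theory.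
Local Open Scope classical_set_scope.
Local Open Scope ring_scope.

Section Defs.
Variable R : realType.

Definition is_metric (X : Type) (d : X -> X -> R) : Prop :=
  (forall x y, 0 <= d x y) /\
  (forall x y, d x y = 0 <-> x = y) /\
  (forall x y, d x y = d y x) /\
  (forall x y z, d x z <= d x y + d y z).

Definition generates_topology (X : topologicalType) (d : X -> X -> R) : Prop :=
  forall A : set X, open A <->
    (forall x, A x -> exists2 e : R, 0 < e & [set y | d x y < e] `<=` A).

Definition Met (X : topologicalType) : set (X -> X -> R) :=
  [set d | @is_metric X d /\ @generates_topology X d].

Definition metrizable (X : topologicalType) : Prop := exists d, Met X d.

Definition DX (X : topologicalType) (d e : X -> X -> R) : \bar R :=
  ereal_sup [set ((`|d xy.1 xy.2 - e xy.1 xy.2|)%:E) | xy in [set: X * X]].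

Definition linf_dist (N : nat) (u v : 'I_N -> R) : R :=
  \big[Order.max/0]_(i < N) `|u i - v i|.

Definition linf_embeddable (X : Type) (d : X -> X -> R) : Prop :=
  exists N : nat, (1 <= N)%N /\
    exists f : X -> 'I_N -> R, forall x y, d x y = @linf_dist N (f x) (f y).
End Defs.

Definition covering_dim_le (X : topologicalType) (n : nat) : Prop :=
  forall (I : finType) (U : I -> set X),
    (forall i, open (U i)) -> (forall x, exists i, U i x) ->
    exists (J : finType) (V : J -> set X),
      [/\ (forall j, open (V j)),
          (forall x, exists j, V j x),
          (forall j, exists i, V j `<=` U i) &
          (forall x, (#|[pred j | `[< V j x >]]| <= n.+1)%N)].

Definition finite_dimensional (X : topologicalType) : Prop :=
  exists n, covering_dim_le X n.

(* Main.v *)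
Require Import Defs.
From HB Require Import structures.
From mathcomp Require Import all_boot all_order all_algebra.
From mathcomp Require Import all_classical all_reals all_analysis.
From mathcomp Require Import ring lra.
Import Order.TTheory GRing.Theory Num.Theory.
Local Open Scope classical_set_scope.
Local Open Scope ring_scope.

(** The metric [d] is approximated by the sup metric of finitely many functions:
    the distances [d c] to the points [c] of a finite net, which recover [d] up
    to twice the mesh of the net, together with an injective map [g] of small sup
    norm into [R^(2n+3)], which makes the result a metric inducing the topology.

    The map [g] is a uniform limit of Lipschitz maps, each a small perturbation
    of the previous one that separates points at distance at least [1/m] by a gap
    larger than all later perturbations. For one perturbation step, take a fine
    cover [V] of order at most [n+1], the distances [phi j] to the complements of
    the [V j], and [2n+3] thresholds [tau t] below the Lebesgue number. A point
    [x] is near [tau t] through some [phi j x] for at most [n+1] indices [t];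
    otherwise the [t]-th coordinate may be made locally constant near [x], with a
    value determined by the set of the [j] such that [phi j x > tau t]. Any two
    points have an index [t] that is good for both, and if they are far apart
    then the two corresponding sets differ. *)

(** * Truncation, separated values and thresholds on the real line *)

Definition clamp (R : realType) (a u : R) : R := Num.max (- a) (Num.min u a).

Lemma norm_clamp_le (R : realType) (a u : R) : 0 <= a -> `|clamp R a u| <= a.
Proof.
move=> a0; rewrite /clamp ler_norml.
by case: (leP u a) => ?; case: (leP (- a) u) => ?; case: (leP (- a) a) => ?;
  apply/andP; split; lra.
Qed.

Lemma clamp_id (R : realType) (a u : R) : `|u| <= a -> clamp R a u = u.
Proof.
rewrite ler_norml => /andP[h1 h2]; rewrite /clamp.
by rewrite min_l // max_r.
Qed.

Lemma clamp_lipschitz (R : realType) (a b u v : R) :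
  `|clamp R a u - clamp R b v| <= `|a - b| + `|u - v|.
Proof.
have /andP[a1 a2] : - `|a - b| <= a - b <= `|a - b| by rewrite -ler_norml.
have /andP[u1 u2] : - `|u - v| <= u - v <= `|u - v| by rewrite -ler_norml.
move: `|a - b| `|u - v| a1 a2 u1 u2 => p q *.
rewrite /clamp ler_norml.
case: (leP u a) => ?; case: (leP v b) => ?;
  case: (leP (- a) _) => ?; case: (leP (- b) _) => ?; apply/andP; split; lra.
Qed.

(** Round each [a i] down to a multiple of [e], then tell the indices apart by distinct offsets
    below [e]. *)
Lemma separated_approximation (R : realType) (T : finType) (a : T -> R) (e : R) :
  0 < e -> exists2 h : R, 0 < h & exists c : T -> R,
    (forall i, `|c i - a i| <= e) /\
    (forall i j, i != j -> h <= `|c i - c j|).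
Proof.
move=> e0; pose N := #|T|.+1; pose h := e / N%:R.
have h0 : 0 < h by rewrite divr_gt0.
have hN : h * N%:R = e by rewrite divfK // pnatr_eq0.
exists h => //.
(* Multiples of [h] whose residues modulo [N] are the ranks of the indices. *)
pose m i : int := N%:Z * Num.floor (a i / e) + (enum_rank i)%:Z.
exists (fun i => h * (m i)%:~R); split => [i|i j ij].
- have -> : h * (m i)%:~R = e * (Num.floor (a i / e))%:~R + h * (enum_rank i)%:R.
    by rewrite /m intrD intrM mulrDr mulrA -!pmulrn hN.
  have f1 : e * (Num.floor (a i / e))%:~R <= a i.
    by rewrite mulrC -ler_pdivlMr // floor_le.
  have f2 : a i < e * (Num.floor (a i / e))%:~R + e.
    have := lt_succ_floor (a i / e).
    by rewrite intrD ltr_pdivrMr // mulrDl mul1r (mulrC e).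
  have r1 : 0 <= h * (enum_rank i)%:R by rewrite mulr_ge0 // ltW.
  have r2 : h * (enum_rank i)%:R <= e.
    by rewrite -hN ler_pM2l // ler_nat /N ltnW // ltnS ltnW // ltn_ord.
  by rewrite ler_norml; apply/andP; split; lra.
- rewrite -mulrBr normrM gtr0_norm // ler_pMr // -intrB -intr_norm ler1z.
  rewrite -gtz0_ge1 normr_gt0 subr_eq0; apply: contra ij => /eqP mij.
  have : (m i %% N%:Z = m j %% N%:Z)%Z by rewrite mij.
  rewrite /m ![_ * Num.floor _]mulrC !modzMDl !modz_small /=; first last.
  + by rewrite ltz_nat /= /N ltnS ltnW // ltn_ord.
  + by rewrite ltz_nat /= /N ltnS ltnW // ltn_ord.
  by move=> [] /ord_inj /enum_rank_inj ->.
Qed.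

(* A nonzero [p j] lies within [h] of at most one threshold, and a zero [p j]
   of none. *)
Lemma card_near_thresholds (R : realType) (J K : finType) (p : J -> R)
    (tau : K -> R) (h : R) :
  (forall t, h <= tau t) ->
  (forall t u, t != u -> 2 * h <= `|tau t - tau u|) ->
  (#|[set t | [exists j, (`|p j - tau t| < h)%R]]%SET|
     <= #|[pred j | p j != 0%R]|)%N.
Proof.
move=> taug taus; set A := finset _.
pose g t := [pick j | `|p j - tau t| < h].
have gP t : t \in A -> exists2 j, g t = Some j & `|p j - tau t| < h.
  rewrite inE => /existsP[j jt]; rewrite /g.
  by case: pickP => [k kt|/(_ j)]; [exists k | rewrite jt].
have gi : {in A &, injective g}.
  move=> t u /gP[j -> jt] /gP[k -> ku] [jk]; rewrite -{}jk in ku.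
  apply/eqP; apply: contraT => /taus.
  have := ler_distD (p j) (tau t) (tau u); rewrite (distrC (tau t) (p j)) => *; lra.
rewrite -(card_in_imset gi).
rewrite -[leqRHS]cardsE -[leqRHS](card_imset _ Some_inj).
apply: subset_leq_card; apply/fintype.subsetP => _ /imsetP[t /gP[j -> jt] ->].
rewrite imset_f // !inE; apply: contraTneq jt => ->.
rewrite sub0r normrN -leNgt (le_trans (taug t)) //; exact: ler_norm.
Qed.

(** * Compactness in metric terms *)

Lemma Met_ball_open (R : realType) (X : topologicalType) (d : X -> X -> R) (x : X)
    (r : R) :
  Met R X d -> open [set y | d x y < r].
Proof.
move=> [[_ [_ [_ dtri]]] dtop]; apply/dtop => y /= xy.
exists (r - d x y); first by rewrite subr_gt0.
by move=> z /=; have := dtri x y z => *; lra.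
Qed.

Lemma finite_ball_cover (R : realType) (X : topologicalType) (d : X -> X -> R)
    (rho : X -> R) :
  compact [set: X] -> Met R X d -> (forall x, 0 < rho x) ->
  exists s : seq X, forall x, exists2 c, c \in s & d c x < rho c.
Proof.
move=> cX dM rho0.
have [[x0]|X0] := pselect (exists x : X, True); last first.
  by exists [::] => x; exfalso; apply: X0; exists x.
(* With a base point, the open-cover form of compactness applies; the empty space was set aside
   above. *)
pose Y : ptopologicalType := HB.pack (Topological.sort X) (isPointed.Build X x0).
have : cover_compact [set: Y] by rewrite -compact_cover.
move=> /(_ X setT (fun c => [set y | d c y < rho c])) [].
- by move=> c _; exact: Met_ball_open.
- move=> x _; exists x => //=.
  by have [[_ [d0 _]] _] := dM; rewrite (proj2 (d0 x x) erefl).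
- move=> s _ sc; exists (finmap.enum_fset s) => x.
  by have [c /= cs cx] := sc x I; exists c.
Qed.

(** Each [x] gets a radius whose double still fits in some [V j]. If [x] is within [rho c] of a net
    point [c], a ball around [x] of radius at most [rho c] stays in the doubled ball. *)
Lemma lebesgue_number (R : realType) (X : topologicalType) (d : X -> X -> R)
    (J : Type) (V : J -> set X) :
  compact [set: X] -> Met R X d -> (forall j, open (V j)) ->
  (forall x, exists j, V j x) ->
  exists2 l : R, 0 < l & forall x, exists j, [set y | d x y < l] `<=` V j.
Proof.
move=> cX dM Vo Vc; have [[_ [_ [_ dtri]]] dtop] := dM.
have : forall x, exists r : R,
    0 < r /\ exists j, [set y | d x y < r + r] `<=` V j.
  move=> x; have [j jx] := Vc x.
  have [r r0 rV] := (proj1 (dtop _) (Vo j)) x jx.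
  exists (r / 2); split; first lra.
  by exists j => y /= xy; apply: rV => /=; lra.
move=> /choice[rho rhoP].
have [s sP] := finite_ball_cover R X d rho cX dM (fun x => (rhoP x).1).
(* The default [1] keeps the minimum positive when [s] is empty. *)
exists (\big[Num.min/1]_(c <- s) rho c).
  by apply: lt_bigmin => // c _; have [] := rhoP c.
move=> x; have [c cs cx] := sP x; have [_ [j jV]] := rhoP c.
exists j => y /= xy; apply: jV => /=.
have := @ge_bigmin_seq _ _ _ s 1 c xpredT rho cs isT.
by have := dtri c x y => *; lra.
Qed.

Lemma distance_to_complement (R : realType) (X : Type) (d : X -> X -> R)
    (V : set X) (l : R) :
  is_metric R X d -> 0 < l -> exists phi : X -> R,
    [/\ forall x y, `|phi x - phi y| <= d x y,
        forall x, phi x != 0 -> V x &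
        forall x, [set y | d x y < l] `<=` V -> l <= phi x].
Proof.
move=> [dge0 [d0 [dsym dtri]]] l0.
(* Including [l] keeps the infimum meaningful when [V] is the whole space; it truncates the distance
   at [l]. *)
pose D x := l |` [set d x y | y in ~` V].
have Dlb x : lbound (D x) 0.
  by move=> _ [->|[y _ <-]] //; exact: ltW.
have Dl x : D x !=set0 by exists l; left.
have phiP x r : D x r -> inf (D x) <= r by apply: ge_inf; exists 0.
have phi0 x : 0 <= inf (D x) by exact: lb_le_inf.
have phiL x y : inf (D x) <= inf (D y) + d x y.
  rewrite -lerBlDr; apply: lb_le_inf => // _ [->|[z Vz <-]].
  - have : inf (D x) <= l by apply: phiP; left.
    by have := dge0 x y => *; lra.
  - have : inf (D x) <= d x z by apply: phiP; right; exists z.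
    by have := dtri x y z => *; lra.
exists (fun x => inf (D x)); split => [x y|x|x xV].
- have := phiL x y; have := phiL y x; rewrite (dsym y x) ler_norml => *.
  by apply/andP; split; lra.
- apply: contra_neqP => Vx; apply/eqP; rewrite eq_le phi0 andbT.
  by rewrite -(proj2 (d0 x x) erefl); apply: phiP; right; exists x.
- apply: lb_le_inf => // _ [->//|[y Vy <-]].
  by rewrite leNgt; apply/negP => /xV.
Qed.

(** * One perturbation step *)

Definition lipschitz_family (R : realType) (X T : Type) (d : X -> X -> R)
    (f : T -> X -> R) : Prop :=
  exists2 L : R, 0 <= L & forall t x y, `|f t x - f t y| <= L * d x y.

Lemma small_cover (R : realType) (X : topologicalType) (n : nat)
    (d : X -> X -> R) (r : R) :
  compact [set: X] -> covering_dim_le X n -> Met R X d -> 0 < r ->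
  exists (J : finType) (V : J -> set X),
    [/\ forall j, open (V j), forall x, exists j, V j x,
        forall j x y, V j x -> V j y -> d x y < r &
        forall x, (#|[pred j | `[< V j x >]]| <= n.+1)%N].
Proof.
move=> cX dimX dM r0; have [[_ [_ [dsym dtri]]] _] := dM.
have r20 : 0 < r / 2 by rewrite divr_gt0.
have [s sP] := finite_ball_cover R X d (fun=> r / 2) cX dM (fun=> r20).
have [||J [V [Vo Vc VU Vn]]] := dimX (seq_sub s)
  (fun c => [set y | d (ssval c) y < r / 2]).
- by move=> c; exact: Met_ball_open.
- by move=> x; have [c cs cx] := sP x; exists (SeqSub cs).
exists J, V; split => // j x y jx jy; have [c Vc'] := VU j.
have := Vc' x jx; have := Vc' y jy => /=.
by have := dtri x (ssval c) y; rewrite (dsym x (ssval c)) => *; lra.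
Qed.

(** The factor 4 leaves room for the later perturbations: they move each of two points by at most
    [delta'], so a gap of [2 * delta'] survives. *)
Lemma separating_perturbation (R : realType) (X : topologicalType) (n : nat)
    (d : X -> X -> R) (f : 'I_(n.*2.+3) -> X -> R) (delta eps : R) :
  compact [set: X] -> covering_dim_le X n -> Met R X d ->
  lipschitz_family R X _ d f -> 0 < delta -> 0 < eps ->
  exists (f' : 'I_(n.*2.+3) -> X -> R) (delta' : R),
    [/\ lipschitz_family R X _ d f', 0 < delta', delta' <= delta / 2,
        forall t x, `|f' t x - f t x| <= delta / 2 &
        forall x y, eps <= d x y -> exists t, 4 * delta' <= `|f' t x - f' t y|].
Proof.
move=> cX dimX dM [L L0 fL] delta0 eps0.
have [dmet dtop] := dM; have [dge0 [d0 [dsym dtri]]] := dmet.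
(* Sets of diameter below [r] cannot contain two points at distance [eps], and [f] varies by at most
   [delta / 4] on them. [L + 1] avoids a zero denominator. *)
pose r := Num.min eps (delta / 4 / (L + 1)).
have L10 : 0 < L + 1 by lra.
have r0 : 0 < r by rewrite lt_min eps0 !divr_gt0.
have fr t x y : d x y < r -> `|f t x - f t y| <= delta / 4.
  rewrite lt_min => /andP[_]; rewrite ltr_pdivlMr // => xy.
  by apply: le_trans (fL t x y) _; have := dge0 x y; nra.
have [J [V [Vo Vc Vr Vn]]] := small_cover R X n d r cX dimX dM r0.
have [l l0 lV] := lebesgue_number R X d J V cX dM Vo Vc.
have /choice[phi phiP] := fun j => distance_to_complement R X d (V j) l dmet l0.
(* The thresholds will be [2h, 4h, ..., 2Kh], all below [l = 2(K+1)h]. *)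
pose K := n.*2.+3; pose h := l / K.+1%:R / 2.
have h0 : 0 < h by rewrite !divr_gt0.
have hK : 2 * h * K.+1%:R = l.
  by rewrite /h [2 * _]mulrC !divfK // pnatr_eq0.
pose tau (t : 'I_K) := 2 * h * t.+1%:R.
have tauh t : h <= tau t.
  have : 1 <= t.+1%:R :> R by rewrite ler1n.
  by rewrite /tau; nra.
have taul t : tau t < l.
  by rewrite -hK /tau ltr_pM2l ?mulr_gt0 // ltr_nat ltnS ltn_ord.
have taus t u : t != u -> 2 * h <= `|tau t - tau u|.
  move=> tu; rewrite /tau -mulrBr normrM gtr0_norm; last lra.
  rewrite ler_pMr; last lra.
  rewrite !pmulrn -intrB -intr_norm ler1z -gtz0_ge1 normr_gt0 subr_eq0.
  by apply: contra tu => /eqP[] /ord_inj ->.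
pose S t x : {set J} := [set j | tau t < phi j x]%SET.
(* Some [phi j x] reaches [l], so [S t x] is nonempty; points with the same set thus share some
   [V j]. *)
have SV t x y : S t x = S t y -> d x y < r.
  move=> Sxy; have [j jV] := lV x; have [_ phiV phil] := phiP j.
  have jx : j \in S t x by rewrite inE (lt_le_trans (taul t)) // phil.
  have phiVS z : j \in S t z -> V j z.
    rewrite inE => jz; apply: phiV; rewrite gt_eqF // (lt_trans _ jz) //.
    exact: lt_le_trans (tauh t).
  by apply: (Vr j); apply: phiVS; rewrite -?Sxy.
have : forall i : 'I_K * {set J}, exists a : R,
    forall x, S i.1 x = i.2 -> `|f i.1 x - a| <= delta / 4.
  move=> [t A] /=; have [[z zA]|zA] := pselect (exists z, S t z = A).
    by exists (f t z) => x xA; apply/fr/(SV t); rewrite xA.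
  by exists 0 => x xA; exfalso; apply: zA; exists x.
move=> /choice[a aP].
have delta40 : 0 < delta / 4 by lra.
have [g g0 [c [ca cg]]] := separated_approximation R _ a (delta / 4) delta40.
(* [mu t] vanishes wherever [S t] jumps, which keeps the perturbation [w t]
   Lipschitz. *)
pose mu t x := \big[Num.min/h]_j `|phi j x - tau t|.
have mu0 t x : 0 <= mu t x by apply: le_bigmin => // *; exact: ltW.
have muh t x : mu t x <= h by exact: bigmin_le_id.
have muj t x j : mu t x <= `|phi j x - tau t| by exact: bigmin_le.
have mu_eq t x : (forall j, h <= `|phi j x - tau t|) -> mu t x = h.
  by move=> hj; apply: bigmin_eq_id.
have muL t x y : mu t x <= mu t y + d x y.
  rewrite -lerBlDr; apply: le_bigmin => [|j _].
    by have := muh t x; have := dge0 x y => *; lra.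
  have [phiL _ _] := phiP j.
  have := muj t x j; have := phiL x y.
  by have := ler_distD (phi j y) (phi j x) (tau t) => *; lra.
(* Chosen so that [M * mu t x] is at most [delta / 2], with equality when [mu t x = h]. *)
pose M := delta / 2 / h.
have M0 : 0 < M by rewrite !divr_gt0.
have Mh : M * h = delta / 2 by rewrite divfK // gt_eqF.
(* The correction that would move [f t x] to the value assigned to [S t x], truncated so as to
   vanish with [mu]. *)
pose w t x := clamp R (M * mu t x) (c (t, S t x) - f t x).
have wM t x : `|w t x| <= M * mu t x.
  by apply: norm_clamp_le; have := mu0 t x; nra.
have wL t x y : `|w t x - w t y| <= (M + L) * d x y.
  have [Sxy|/eqP Sxy] := eqVneq (S t x) (S t y).
    rewrite /w Sxy; apply: le_trans (clamp_lipschitz _ _ _ _ _) _.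
    rewrite mulrDl; apply: lerD.
      rewrite -mulrBr normrM gtr0_norm // ler_pM2l // ler_norml.
      have := muL t x y; have := muL t y x; rewrite (dsym y x) => *.
      by apply/andP; split; lra.
    have -> : c (t, S t y) - f t x - (c (t, S t y) - f t y) = f t y - f t x.
      by ring.
    by rewrite distrC.
  have [j jxy] : exists j, (tau t < phi j x) != (tau t < phi j y).
    apply: contrapT => /forallNP hj; apply: Sxy; apply/setP => j; rewrite !inE.
    by apply/eqP; apply: contraT => /hj.
  (* [tau t] separates [phi j x] from [phi j y], so their distances to it add up to
     [|phi j x - phi j y|]. *)
  have muxy : mu t x + mu t y <= d x y.
    have [phiL _ _] := phiP j; apply: le_trans (phiL x y).
    apply: le_trans (lerD (muj t x j) (muj t y j)) _.
    move: jxy; case: (ltP (tau t) (phi j x)) => jx;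
      case: (ltP (tau t) (phi j y)) => jy // _.
      rewrite (gtr0_norm (_ : 0 < phi j x - tau t)) ?subr_gt0 //.
      rewrite (ler0_norm (_ : phi j y - tau t <= 0)) ?subr_le0 //.
      by apply: le_trans (ler_norm _); lra.
    rewrite (gtr0_norm (_ : 0 < phi j y - tau t)) ?subr_gt0 //.
    rewrite (ler0_norm (_ : phi j x - tau t <= 0)) ?subr_le0 //.
    by rewrite (distrC (phi j x)); apply: le_trans (ler_norm _); lra.
  apply: le_trans (ler_normB _ _) _.
  have := wM t x; have := wM t y; have := dge0 x y => *; nra.
(* Here the truncation is inactive: the desired correction is at most
   [delta / 4 + delta / 4 = M * h]. *)
have wc t x : (forall j, h <= `|phi j x - tau t|) ->
    f t x + w t x = c (t, S t x).
  move=> /mu_eq mux; rewrite /w mux Mh clamp_id; first by ring.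
  apply: le_trans (ler_distD (a (t, S t x)) _ _) _.
  have := ca (t, S t x); have := aP (t, S t x) x erefl => /=.
  by rewrite (distrC (f t x)) => *; lra.
exists (fun t x => f t x + w t x), (Num.min (g / 4) (delta / 2)); split.
- exists (M + L + L); first by lra.
  move=> t x y.
  have -> : f t x + w t x - (f t y + w t y) =
      (w t x - w t y) + (f t x - f t y) by ring.
  by rewrite mulrDl; apply: le_trans (ler_normD _ _) _; apply: lerD.
- by rewrite lt_min !divr_gt0.
- by rewrite ge_min lexx orbT.
- move=> t x; rewrite addrC addKr -Mh.
  by apply: le_trans (wM t x) _; rewrite ler_pM2l.
- move=> x y exy.
  pose B z := [set t : 'I_K | [exists j, (`|phi j z - tau t| < h)%R]]%SET.
  have Bn z : (#|B z| <= n.+1)%N.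
    apply: leq_trans (card_near_thresholds R _ _ (phi^~ z) tau h tauh taus) _.
    apply: leq_trans (Vn z); apply/subset_leq_card/fintype.subsetP => j.
    by rewrite !inE => jz; have [_ phiV _] := phiP j; exact: phiV.
  (* At most [2(n+1)] of the [2n+3] indices are bad for [x] or [y]. *)
  have [t tB] : exists t, t \notin (B x :|: B y)%SET.
    apply/existsP; rewrite -negb_forall; apply/negP => /forallP allB.
    have : (#|'I_K| <= #|B x :|: B y|)%N.
      by apply: subset_leq_card; apply/fintype.subsetP.
    rewrite card_ord cardsU; apply/negP; rewrite -ltnNge.
    apply: leq_ltn_trans (leq_subr _ _) _.
    apply: leq_ltn_trans (leq_add (Bn x) (Bn y)) _.
    by rewrite addSn addnS addnn.
  exists t; move: tB; rewrite !inE negb_or !negb_exists.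
  move=> /andP[/forallP tx /forallP ty].
  rewrite !wc; try by move=> j; rewrite leNgt.
  apply: (@le_trans _ _ g).
    by have := ge_min (g / 4) (g / 4) (delta / 2); rewrite lexx /= => ?; lra.
  apply: cg; apply/eqP => -[] /SV; apply/negP; rewrite -leNgt.
  by apply: le_trans exy; rewrite ge_min lexx.
Qed.

(** * Passage to the limit *)

(** The intervals of center [u m] and radius [r m] decrease, so the supremum of their left ends lies
    in all of them. *)
Lemma nested_intervals (R : realType) (u r : nat -> R) :
  (forall m, 0 <= r m) -> (forall m, `|u m.+1 - u m| <= r m - r m.+1) ->
  exists v, forall m, `|v - u m| <= r m.
Proof.
move=> r0 ur.
have urm m : - (r m - r m.+1) <= u m.+1 - u m <= r m - r m.+1.
  by rewrite -ler_norml.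
have lo m n : (m <= n)%N -> u m - r m <= u n - r n.
  elim: n => [|n IHn]; first by rewrite leqn0 => /eqP ->.
  rewrite leq_eqVlt => /predU1P[-> //|]; rewrite ltnS => /IHn.
  by have /andP[? ?] := urm n => *; lra.
have hi m n : (m <= n)%N -> u n + r n <= u m + r m.
  elim: n => [|n IHn]; first by rewrite leqn0 => /eqP ->.
  rewrite leq_eqVlt => /predU1P[-> //|]; rewrite ltnS => /IHn.
  by have /andP[? ?] := urm n => *; lra.
have lohi m n : u m - r m <= u n + r n.
  have := lo m _ (leq_maxl m n); have := hi n _ (leq_maxr m n).
  by have := r0 (maxn m n) => *; lra.
pose E := range (fun m => u m - r m).
exists (sup E) => m.
have h1 : u m - r m <= sup E.
  apply: ub_le_sup; last by exists m.
  by exists (u 0%N + r 0%N) => _ [k _ <-].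
have h2 : sup E <= u m + r m.
  apply: ge_sup; first by exists (u m - r m); exists m.
  by move=> _ [k _ <-].
by rewrite ler_norml; apply/andP; split; lra.
Qed.

Lemma small_uniform_embedding (R : realType) (X : topologicalType) (n : nat)
    (d : X -> X -> R) (e0 : R) :
  compact [set: X] -> covering_dim_le X n -> Met R X d -> 0 < e0 ->
  exists f : 'I_(n.*2.+3) -> X -> R,
    [/\ forall t x, `|f t x| <= e0,
        forall e, 0 < e -> exists2 r : R, 0 < r &
          forall x y, d x y < r -> forall t, `|f t x - f t y| < e &
        forall e, 0 < e -> exists2 r : R, 0 < r &
          forall x y, (forall t, `|f t x - f t y| < r) -> d x y < e].
Proof.
move=> cX dimX dM e00; have [[dge0 _] _] := dM.
(* A state is the current map together with a bound on all later perturbations; stage [m] separates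
   points at distance at least [1/(m+1)]. *)
pose state : Type := (('I_(n.*2.+3) -> X -> R) * R)%type.
pose valid (s : state) := lipschitz_family R X _ d s.1 /\ 0 < s.2.
pose next m (s s' : state) := [/\ s'.2 <= s.2 / 2,
  forall t x, `|s'.1 t x - s.1 t x| <= s.2 / 2 &
  forall x y, m.+1%:R^-1 <= d x y ->
    exists t, 4 * s'.2 <= `|s'.1 t x - s'.1 t y|].
have : forall ms : nat * state, exists s',
    valid ms.2 -> valid s' /\ next ms.1 ms.2 s'.
  move=> [m s] /=; have [[sL s0]|?] := pselect (valid s); last by exists s.
  have m0 : 0 < m.+1%:R^-1 :> R by rewrite invr_gt0.
  have [f' [e' [f'L e'0 e's f's f'e]]] :=
    separating_perturbation R X n d s.1 s.2 _ cX dimX dM sL s0 m0.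
  by exists (f', e') => _.
move=> /choice[G GP].
pose s := fix s m : state :=
  if m is k.+1 then G (k, s k) else ((fun _ _ => 0), e0).
have sV m : valid (s m).
  elim: m => [|m IHm] /=; last by have [] := GP (m, s m) IHm.
  by split=> //=; exists 0 => // t x y; rewrite subrr normr0 mul0r.
have sN m : next m (s m) (s m.+1) by have [] := GP (m, s m) (sV m).
have de0 m : 0 < (s m).2 by have [] := sV m.
(* Halving beats the harmonic rate because [m + 2 <= 2(m + 1)]; this rate suffices for the
   Archimedean argument. *)
have dem m : (s m).2 * m.+1%:R <= e0.
  elim: m => [|m IHm]; first by rewrite /= mulr1.
  have [h _ _] := sN m; apply: le_trans _ IHm.
  have := de0 m; have : 0 <= m%:R :> R by [].
  rewrite -(natr1 m.+1) -(natr1 m); move: (m%:R) h => k *; nra.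
have dec e : 0 < e -> exists m, (s m).2 < e.
  move=> e0'; exists (Num.bound (e0 / e)).
  have := archi_boundP (ltW (divr_gt0 e00 e0')).
  set k := Num.bound _; rewrite ltr_pdivrMr // => ek.
  rewrite -(@ltr_pM2r _ k.+1%:R) //; apply: le_lt_trans (dem k) _.
  by apply: lt_le_trans ek _; rewrite mulrC ler_pM2l // ler_nat.
have : forall tx : 'I_(n.*2.+3) * X, exists v, forall m,
    `|v - (s m).1 tx.1 tx.2| <= (s m).2.
  move=> [t x] /=; apply: (nested_intervals R (fun m => (s m).1 t x)) => m.
    exact: ltW.
  by have [h1 h2 _] := sN m; apply: le_trans (h2 t x) _; lra.
move=> /choice[f fP]; pose g t x := f (t, x).
have gP t x m : `|g t x - (s m).1 t x| <= (s m).2 by exact: (fP (t, x)).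
exists g; split.
- by move=> t x; have := gP t x 0%N; rewrite /= subr0.
- move=> e e0'; have [|m me] := dec (e / 4); first lra.
  have [[L L0 sL] _] := sV m.
  exists (e / 4 / (L + 1)); first by rewrite !divr_gt0 //; lra.
  move=> x y; rewrite ltr_pdivlMr; last lra.
  move=> xy t; have := sL t x y; have := gP t x m; have := gP t y m.
  have := ler_distD ((s m).1 t x) (g t x) (g t y).
  have := ler_distD ((s m).1 t y) ((s m).1 t x) (g t y).
  rewrite (distrC ((s m).1 t y) (g t y)).
  have := dge0 x y => *; nra.
- move=> e e0'.
  have [m me] : exists m : nat, m.+1%:R^-1 < e.
    exists (Num.bound e^-1).
    rewrite -[ltRHS]invrK ltf_pV2 ?posrE ?invr_gt0 ?ltr0n //.
    apply: lt_le_trans (archi_boundP _) _; first by rewrite invr_ge0 ltW.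
    by rewrite ler_nat.
  (* What remains of the gap [4 * (s m.+1).2] after an error of [(s m.+1).2] at each point. *)
  exists (2 * (s m.+1).2); first by rewrite mulr_gt0.
  move=> x y xy; rewrite ltNge; apply/negP => exy.
  have [_ _ /(_ x y (ltW (lt_le_trans me exy)))[t]] := sN m.
  have := xy t; have := gP t x m.+1; have := gP t y m.+1.
  have := ler_distD (g t x) ((s m.+1).1 t x) ((s m.+1).1 t y).
  have := ler_distD (g t y) (g t x) ((s m.+1).1 t y).
  rewrite (distrC ((s m.+1).1 t x) (g t x)) => *; lra.
Qed.

(** * Uniform equivalence and pulled-back sup metrics *)

Lemma Met_uniformly_equivalent (R : realType) (X : topologicalType)
    (d q : X -> X -> R) :
  Met R X d -> is_metric R X q ->
  (forall e, 0 < e -> exists2 r : R, 0 < r & forall x y, d x y < r -> q x y < e) ->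
  (forall e, 0 < e -> exists2 r : R, 0 < r & forall x y, q x y < r -> d x y < e) ->
  Met R X q.
Proof.
move=> [_ dtop] qmet dq qd; split=> // A; split=> [/dtop Ad x Ax|Aq].
- have [e e0 eA] := Ad x Ax; have [r r0 rP] := qd e e0.
  by exists r => // y /= /rP; exact: eA.
- apply/dtop => x Ax; have [e e0 eA] := Aq x Ax; have [r r0 rP] := dq e e0.
  by exists r => // y /= /rP; exact: eA.
Qed.

Lemma linf_dist_ge (R : realType) (N : nat) (u v : 'I_N -> R) (i : 'I_N) :
  `|u i - v i| <= linf_dist R N u v.
Proof. exact: (le_bigmax 0 (fun i => `|u i - v i|)). Qed.

Lemma linf_dist_ge0 (R : realType) (N : nat) (u v : 'I_N -> R) :
  0 <= linf_dist R N u v.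
Proof. exact: bigmax_ge_id. Qed.

Lemma linf_dist_le (R : realType) (N : nat) (u v : 'I_N -> R) (r : R) :
  0 <= r -> (forall i, `|u i - v i| <= r) -> linf_dist R N u v <= r.
Proof. by move=> r0 uv; apply: bigmax_le. Qed.

Lemma linf_dist_lt (R : realType) (N : nat) (u v : 'I_N -> R) (r : R) :
  0 < r -> (forall i, `|u i - v i| < r) -> linf_dist R N u v < r.
Proof. by move=> r0 uv; apply: bigmax_lt. Qed.

Lemma linf_dist_pullback_metric (R : realType) (X : Type) (N : nat)
    (f : X -> 'I_N -> R) :
  (forall x y, (forall i, f x i = f y i) -> x = y) ->
  is_metric R X (fun x y => linf_dist R N (f x) (f y)).
Proof.
move=> finj; split; first by move=> x y; exact: linf_dist_ge0.
split=> [x y|].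
  split=> [xy0|->].
    apply: finj => i; apply/eqP; rewrite -subr_eq0 -normr_le0 -xy0.
    exact: linf_dist_ge.
  apply/eqP; rewrite eq_le linf_dist_ge0 andbT.
  by apply: linf_dist_le => // i; rewrite subrr normr0.
split=> [x y|x y z].
  by apply: eq_bigr => i _; rewrite distrC.
apply: linf_dist_le => [|i]; first by rewrite addr_ge0 ?linf_dist_ge0.
by apply: le_trans (ler_distD (f y i) _ _) _; apply: lerD; exact: linf_dist_ge.
Qed.

(** * The approximating metric *)

Theorem theorem2p2 (R : realType) (X : topologicalType) :
  compact [set: X] -> metrizable R X -> finite_dimensional X ->
  let Q := [set d | Met R X d /\ @linf_embeddable R X d] in
  forall d, Met R X d -> forall eps : R, 0 < eps ->
    exists2 q, Q q & (@DX R X d q < eps%:E)%E.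
Proof.
move=> cX _ [n dimX] Q d dM eps eps0.
have [[dge0 [d0 [dsym dtri]]] _] := dM.
have eps40 : 0 < eps / 4 by lra.
have [s sP] := finite_ball_cover R X d (fun=> eps / 4) cX dM (fun=> eps40).
have [g [g_le gd dg]] := small_uniform_embedding R X n d _ cX dimX dM eps40.
pose J : finType := (seq_sub s + 'I_(n.*2.+3))%type.
pose F (j : J) x := match j with inl c => d (ssval c) x | inr t => g t x end.
pose f x (i : 'I_#|J|) := F (enum_val i) x.
pose q x y := linf_dist R _ (f x) (f y).
have qF j x y : `|F j x - F j y| <= q x y.
  by have := linf_dist_ge R _ (f x) (f y) (enum_rank j); rewrite /f enum_rankK.
have dL c x y : `|d c x - d c y| <= d x y.
  have := dtri c x y; have := dtri c y x; rewrite (dsym y x) ler_norml => *.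
  by apply/andP; split; lra.
have qd e : 0 < e -> exists2 r : R, 0 < r & forall x y, q x y < r -> d x y < e.
  move=> /dg[r r0 rP]; exists r => // x y qxy; apply: rP => t.
  exact: le_lt_trans (qF (inr t) x y) qxy.
have dq e : 0 < e -> exists2 r : R, 0 < r & forall x y, d x y < r -> q x y < e.
  move=> e0; have [r r0 rP] := gd e e0.
  exists (Num.min r e); first by rewrite lt_min r0.
  move=> x y; rewrite lt_min => /andP[xyr xye]; apply: linf_dist_lt => // i.
  rewrite /f; case: (enum_val i) => [c|t] /=; last exact: rP.
  exact: le_lt_trans xye.
have qmet : is_metric R X q.
  apply: linf_dist_pullback_metric => x y fxy; apply/d0/eqP.
  rewrite eq_le dge0 andbT; apply/ler_addgt0Pl => e /dg[r r0 rP].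
  rewrite addr0; apply/ltW/rP => t.
  have := fxy (enum_rank (inr t)); rewrite /f enum_rankK /= => ->.
  by rewrite subrr normr0.
exists q.
  split; first exact: Met_uniformly_equivalent dM qmet dq qd.
  exists #|J|; split; last by exists f.
  (* The coordinates of [g] make the dimension positive even if the net is empty. *)
  by apply/card_gt0P; exists (inr ord0).
(* A pointwise bound by [eps / 2] keeps the supremum strictly below [eps]. *)
apply: (@le_lt_trans _ _ (eps / 2)%:E); last by rewrite lte_fin; lra.
apply: ge_ereal_sup => _ [[x y] _ <-] /=; rewrite lee_fin ler_norml.
have qle : q x y <= d x y + eps / 2.
  apply: linf_dist_le => [|i]; first by have := dge0 x y => ?; lra.
  rewrite /f; case: (enum_val i) => [c|t] /=.
    by apply: le_trans (dL _ x y) _; lra.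
  apply: le_trans (ler_normB _ _) _.
  by have := g_le t x; have := g_le t y; have := dge0 x y => *; lra.
(* For a net point [c] near [x], [d c y - d c x] falls short of [d x y] by at most [2 * d c x]. *)
have qge : d x y <= q x y + eps / 2.
  have [c cs cx] := sP x; have := qF (inl (SeqSub cs)) x y => /=.
  rewrite ler_norml => /andP[? ?].
  by have := dtri x c y; rewrite (dsym x c) => *; lra.
by apply/andP; split; lra.
Qed.
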